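(* Let $n\ge1$, $0\le k<n$, and let $A,B\subseteq[n]$ with $|A|=|B|=k+1$. Then $$\mathrm{lm}_\preceq(\det M(A,B))=\prod_{(i,j)\in N(A,B)}x_{ij}.$$
   Context: $X=(x_{ij})_{1\le i,j\le n}$ is a matrix of indeterminates over a field $\mathbb K$. For $A,B\subseteq[n]$ of equal size, $M(A,B)=(x_{ij})_{i\in A,j\in B}$ is the corresponding submatrix. For $s\ge1$ and $A=\{a_1<\dots<a_s\}$, $B=\{b_1<\dots<b_s\}$, let $\ell$ be the least integer $0\le\ell\le s$ such that $a_{i+\ell}>b_i$ for all $1\le i\le s-\ell$. Then $N(A,B)=\{(a_{(i+\ell)\bmod s},b_i):i=1,\dots,s\}$, where $\bmod s$ takes values in $\{1,\dots,s\}$. Term order $\preceq$: let $\varphi(i,j)=\big[((2-i)n+(j-1)(n-1)-1)\bmod n^2\big]+1$, with the usual residue in $\{0,\dots,n^2-1\}$. This is a bijection $[n]^2\to[n^2]$. Order the variables by $x_{ij}\preceq x_{kl}$ iff $\varphi(i,j)\le\varphi(k,l)$. Then $\preceq$ is the degree reverse lexicographic order for this variable order: $m\prec m'$ if $\deg m<\deg m'$, or if the degrees are equal and, at the $\preceq$-smallest variable where the exponents differ, $m$ has the larger exponent. $\mathrm{lm}_\preceq(f)$ is the $\preceq$-largest monomial of $f$ with nonzero coefficient. *)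

(* Defs.v *)
From HB Require Import structures.
From mathcomp Require Import all_boot all_order all_algebra.
From mathcomp Require Import zify.
From mathcomp.multinomials Require Import mpoly.

Set Implicit Arguments.
Unset Strict Implicit.
Unset Printing Implicit Defensive.

Import Order.TTheory GRing.Theory Num.Theory.

Local Open Scope ring_scope.

(* Rows and columns are indexed from 0: the ordinal i : 'I_n stands for the
   index i + 1 of [n]. The indeterminate x_ij is the variable of
   {mpoly K[n * n]} of number mxvec_index i j. *)
Definition var n (i j : 'I_n) : 'I_(n * n) := mxvec_index i j.

Definition genmx_X (K : fieldType) n : 'M[{mpoly K[n * n]}]_n :=
  \matrix_(i, j) 'X_(var i j).

(* elt hA i is a_(i+1), where A = {a_1 < ... < a_s}; see elt_lt. *)
Definition elt n s (A : {set 'I_n}) (hA : #|A| = s) (i : 'I_s) : 'I_n :=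
  enum_val (cast_ord (esym hA) i).

Lemma elt_in n s (A : {set 'I_n}) (hA : #|A| = s) (i : 'I_s) : elt hA i \in A.
Proof. exact: enum_valP. Qed.

Lemma elt_lt n s (A : {set 'I_n}) (hA : #|A| = s) (i j : 'I_s) :
  (i < j)%N -> (elt hA i < elt hA j)%N.
Proof.
move=> ltij; rewrite /elt !(enum_val_nth (elt hA i)) /=.
have srt : sorted (fun x y : 'I_n => (x < y)%N) (enum A).
  rewrite /enum_mem; apply: sorted_filter; first by move=> x y z; apply: ltn_trans.
  by have := iota_ltn_sorted 0 n; rewrite -val_enum_ord sorted_map enumT.
apply: (sorted_ltn_nth _ _ srt) => //; first by move=> x y z; apply: ltn_trans.
- by rewrite inE -cardE hA.
- by rewrite inE -cardE hA.
Qed.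

Definition submat (K : fieldType) n s (A B : {set 'I_n})
    (hA : #|A| = s) (hB : #|B| = s) : 'M[{mpoly K[n * n]}]_s :=
  mxsub (elt hA) (elt hB) (genmx_X K n).

Definition good_shift n s (A B : {set 'I_n}) (hA : #|A| = s) (hB : #|B| = s)
    (l : nat) : bool :=
  (l <= s)%N &&
  [forall i : 'I_s, forall j : 'I_s,
     (j == i + l :> nat)%N ==> (elt hB i < elt hA j)%N].

Lemma good_shift_ex n s (A B : {set 'I_n}) (hA : #|A| = s) (hB : #|B| = s) :
  exists l, good_shift hA hB l.
Proof.
exists s; rewrite /good_shift leqnn /=.
apply/forallP => i; apply/forallP => j; apply/implyP => /eqP E.
by have := ltn_ord j; rewrite E ltnNge leq_addl.
Qed.

Definition shift n s (A B : {set 'I_n}) (hA : #|A| = s) (hB : #|B| = s) : nat :=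
  ex_minn (good_shift_ex hA hB).

(* With indices starting from 0, the residue of i + l in {1, ..., s} becomes
   the usual residue in {0, ..., s - 1}, that is inZp (i + l) : 'I_s. *)
Definition Nset n k (A B : {set 'I_n}) (hA : #|A| = k.+1) (hB : #|B| = k.+1) :
    {set 'I_n * 'I_n} :=
  [set (elt hA (inZp (i + shift hA hB)), elt hB i) | i : 'I_k.+1].

Definition phi n (i j : 'I_n) : int :=
  let i1 : int := i.+1%:Z in
  let j1 : int := j.+1%:Z in
  (((2 - i1) * n%:Z + (j1 - 1) * (n%:Z - 1) - 1) %% (n%:Z ^+ 2))%Z + 1.

Lemma phi_inj n (i j k l : 'I_n) : phi i j = phi k l -> (i, j) = (k, l).
Proof.
case: n i j k l => [[]//|n] i j k l /addIr /eqP.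
rewrite eqz_mod_dvd => /dvdzP[q E].
have {}E : (k%:Z - i%:Z) * n.+1%:Z + (j%:Z - l%:Z) * n%:Z = q * n.+1%:Z ^+ 2.
  by rewrite -E; lia.
have dvd_small (a b : 'I_n.+1) : (n.+1%:Z %| a%:Z - b%:Z)%Z -> a = b.
  rewrite -eqz_mod_dvd !modz_nat => /eqP[].
  by rewrite !modn_small // => /val_inj.
have ejl : j = l.
  apply: dvd_small; apply/dvdzP; exists (k%:Z - i%:Z + j%:Z - l%:Z - q * n.+1%:Z).
  by lia.
have eki : k = i.
  apply: dvd_small; apply/dvdzP; exists q.
  apply: (@mulIf _ n.+1%:Z) => //.
  by rewrite -mulrA -expr2 -E ejl subrr mul0r addr0.
by rewrite ejl eki.
Qed.

Definition drl_lt n (m m' : 'X_{1..n * n}) : bool :=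
  (mdeg m < mdeg m')%N ||
  (mdeg m == mdeg m') &&
  [exists i : 'I_n, exists j : 'I_n,
     (m' (var i j) < m (var i j))%N &&
     [forall k : 'I_n, forall l : 'I_n,
        (phi k l < phi i j) ==> (m (var k l) == m' (var k l))]].

Definition drl_le n (m m' : 'X_{1..n * n}) : bool := (m == m') || drl_lt m m'.

(* m is the leading monomial of f; unique by is_lm_uniq, and f is then nonzero. *)
Definition is_lm (K : fieldType) n (f : {mpoly K[n * n]}) (m : 'X_{1..n * n}) :
    Prop :=
  m \in msupp f /\ forall m', m' \in msupp f -> drl_le m' m.

Lemma drl_le_anti n (m m' : 'X_{1..n * n}) :
  drl_le m m' -> drl_le m' m -> m = m'.
Proof.
case/orP=> [/eqP //|/orP lt1]; case/orP=> [/eqP //|/orP lt2].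
case: lt1 lt2 => [d1|/andP[/eqP d1 e1]] [d2|/andP[/eqP d2 e2]].
- by have := ltn_trans d1 d2; rewrite ltnn.
- by move: d1; rewrite d2 ltnn.
- by move: d2; rewrite d1 ltnn.
case/existsP: e1 => i /existsP[j /andP[lt1 /forallP eq1]].
case/existsP: e2 => k /existsP[l /andP[lt2 /forallP eq2]].
case: (ltgtP (phi i j) (phi k l)) => [lt|lt|/phi_inj[ei ej]].
- by have /forallP/(_ j) := eq2 i; rewrite lt /= => /eqP E; rewrite E ltnn in lt1.
- by have /forallP/(_ l) := eq1 k; rewrite lt /= => /eqP E; rewrite E ltnn in lt2.
- by rewrite ei ej in lt1; have := ltn_trans lt1 lt2; rewrite ltnn.
Qed.

Lemma is_lm_uniq (K : fieldType) n (f : {mpoly K[n * n]}) m1 m2 :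
  is_lm f m1 -> is_lm f m2 -> m1 = m2.
Proof. by move=> [f1 le1] [f2 le2]; apply: drl_le_anti; [apply: le2|apply: le1]. Qed.

(* Main.v *)
(** Up to an additive constant, [phi] orders the cells [(a, b)] first by
    [(b - a) mod n] and then by decreasing column. On the universal cover of
    the cycle [Z/n] a permutation of the minor moves every column [b] forward
    to a row in [(b, b + n]], and smaller variables correspond to longer moves.
    The number of wrapped cells ([a <= b]) is the mean displacement in indices.
    It is at least [l = shift] for every permutation, because some
    [a_(i+l-1) <= b_i] is a bottleneck. If the smallest cell where a
    permutation [s] and the cyclic shift [N(A, B)] differ belonged to
    [N(A, B)], then every column before it would move to a row strictly
    before its row, so that [s] would have at most [l - 1] wrapped cells. *)
Require Import Defs.
From mathcomp Require Import all_boot all_order all_fingroup all_algebra.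
From mathcomp Require Import zify ring.
From mathcomp.multinomials Require Import mpoly.

Set Implicit Arguments.
Unset Strict Implicit.
Unset Printing Implicit Defensive.

Local Open Scope ring_scope.

Import Order.TTheory GRing.Theory.

(** * The variable order on cells *)

(** In base [n] the residue has the digits [(j - i) mod n] and [n - 1 - j]; when [i > j], making the
    first digit nonnegative costs exactly one [n ^ 2]. *)
Lemma phiE n (i j : 'I_n) :
  phi i j = ((if (i <= j)%N then j - i else j + n - i) * n + (n - j))%N%:Z.
Proof.
have ltin := ltn_ord i; have ltjn := ltn_ord j.
set d : nat := if _ then _ else _.
have ltdn : (d < n)%N by rewrite /d; case: ifP; lia.
have ltn2 : (d * n + (n - j.+1) < n ^ 2)%N by nia.
rewrite /phi.
suff -> : ((2 - i.+1%:Z) * n%:Z + (j.+1%:Z - 1) * (n%:Z - 1) - 1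
    = (if (i <= j)%N then 0 else -1) * n%:Z ^+ 2 + (d * n + (n - j.+1))%N%:Z)%R.
  by rewrite modzMDl modz_small; lia.
have -> : (d * n + (n - j.+1))%N%:Z = d%:Z * n%:Z + n%:Z - j%:Z - 1 by lia.
have -> : d%:Z = j%:Z - i%:Z + (if (i <= j)%N then 0 else n%:Z).
  by rewrite /d; case: ifP; lia.
by case: ifP => _; rewrite -!natr1; ring.
Qed.

(** The move from [b] is at most as long as the one from [b0] to [a0], with equality only if
    [b < b0]. If it starts at or before [b0], it ends before [a0] and cannot wrap; if it wraps, it
    spends [n - b] of its length before row 0. *)
Lemma phi_lt_unwrapped n (a b a0 b0 : 'I_n) :
    phi a0 b0 < phi a b -> (b0 < a0)%N ->
  ((b <= b0) || (a <= b) -> a < a0)%N /\ ((b <= b0) -> b < a)%N.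
Proof.
have := ltn_ord a; have := ltn_ord b; have := ltn_ord a0; have := ltn_ord b0.
rewrite !phiE => ? ? ? ? ltphi ltba.
have {ltphi} : (((if a0 <= b0 then b0 - a0 else b0 + n - a0) <
    (if a <= b then b - a else b + n - a)) ||
  ((if a0 <= b0 then b0 - a0 else b0 + n - a0) ==
   (if a <= b then b - a else b + n - a)) && (b < b0))%N.
  by move: ltphi; do 2!case: ifP => ?; nia.
by do 2!case: ifP => ?; lia.
Qed.

Lemma phi_lt_wrapped n (a b a0 b0 : 'I_n) :
    phi a0 b0 < phi a b -> (a0 <= b0)%N ->
  (b <= b0 -> a <= b -> a < a0)%N.
Proof.
have := ltn_ord a; have := ltn_ord b; have := ltn_ord a0; have := ltn_ord b0.
rewrite !phiE => ? ? ? ? ltphi leab ? leab'.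
by rewrite leab leab' in ltphi; nia.
Qed.

Lemma var_inj n (i j k l : 'I_n) : (var i j == var k l) = ((i, j) == (k, l)).
Proof.
apply/eqP/eqP => [|[-> ->] //].
rewrite /var /mxvec_index => /cast_ord_inj /enum_rank_inj.
by case=> -> ->.
Qed.

Lemma elt_leq n s (A : {set 'I_n}) (hA : #|A| = s) (i j : 'I_s) :
  (elt hA i <= elt hA j)%N = (i <= j)%N.
Proof.
case: (leqP i j) => [|/(elt_lt hA)]; last by lia.
by rewrite leq_eqVlt => /orP[/eqP/val_inj -> //|/(elt_lt hA)]; lia.
Qed.

Lemma elt_inj n s (A : {set 'I_n}) (hA : #|A| = s) : injective (elt hA).
Proof. by move=> i j E; apply/val_inj/eqP; rewrite eqn_leq -!(elt_leq hA) E leqnn. Qed.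

Lemma card_ord_lt m t : (t <= m)%N -> #|[set i : 'I_m | (i < t)%N]| = t.
Proof.
move=> letm; rewrite -sum1dep_card (big_ord_narrow letm).
by rewrite sum1_card card_ord.
Qed.

Lemma card_ord_ge m t : #|[set i : 'I_m | (t <= i)%N]| = (m - t)%N.
Proof.
have [letm|ltmt] := leqP t m; last first.
  rewrite (_ : [set i | _] = set0) ?cards0; first lia.
  by apply/setP => i; rewrite !inE; have := ltn_ord i; lia.
have -> : [set i : 'I_m | (t <= i)%N] = ~: [set i : 'I_m | (i < t)%N].
  by apply/setP => i; rewrite !inE -leqNgt.
by rewrite cardsCs setCK card_ord card_ord_lt.
Qed.

(** * Wrapped cells and the cyclic shift *)

Section Shift.

Variables (n k : nat) (A B : {set 'I_n}).
Hypotheses (hA : #|A| = k.+1) (hB : #|B| = k.+1).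

Local Notation a := (elt hA).
Local Notation b := (elt hB).
Local Notation l := (shift hA hB).

Lemma shift_le : (l <= k.+1)%N.
Proof. by rewrite /shift; case: ex_minnP => l0 /andP[]. Qed.

Lemma shift_good (i j : 'I_k.+1) : (j = i + l :> nat)%N -> (b i < a j)%N.
Proof.
rewrite /shift; case: ex_minnP => l0 /andP[_ /forallP good _] E.
by have /forallP/(_ j)/implyP := good i; apply; apply/eqP.
Qed.

Lemma shift_bottleneck : (0 < l)%N ->
  exists i j : 'I_k.+1, j.+1 = (i + l)%N /\ (a j <= b i)%N.
Proof.
rewrite /shift; case: ex_minnP => -[//|l0] /andP[ltlk _] minl _.
(* By minimality [l - 1] is not a good shift; its failure is the bottleneck. *)
have : ~~ good_shift hA hB l0 by apply/negP => /minl; rewrite ltnn.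
rewrite /good_shift (ltnW ltlk) /= negb_forall => /existsP[i].
rewrite negb_forall => /existsP[j]; rewrite negb_imply -leqNgt => /andP[/eqP E le].
by exists i, j; split=> //; rewrite E addnS.
Qed.

Definition wrapped (s : 'S_k.+1) : {set 'I_k.+1} :=
  [set i | (a (s i) <= b i)%N].

(** Unwrapped columns from [i1] on must land beyond row index [j1], where only [k.+1 - i1 - l] rows
    remain for [k.+1 - i1] columns. *)
Lemma shift_le_wrapped (s : 'S_k.+1) : (l <= #|wrapped s|)%N.
Proof.
have [->//|/shift_bottleneck[i1 [j1 [E le1]]]] := posnP l.
have : ([set i : 'I_k.+1 | i1 <= i] \subset
    wrapped s :|: s @^-1: [set r : 'I_k.+1 | i1 + l <= r])%N.
  apply/subsetP => i; rewrite !inE => lei; apply/orP.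
  case: (leqP (a (s i)) (b i)) => [|lt]; [by left | right].
  by rewrite -E ltnNge -(elt_leq hA); move: lei; rewrite -(elt_leq hB); lia.
move/subset_leq_card; rewrite card_ord_ge => /leq_trans/(_ (leq_card_setU _ _)).
rewrite card_preimset ?card_ord_ge; last exact: perm_inj.
move: #|wrapped s| (ltn_ord j1) => w; lia.
Qed.

Lemma shift_perm_inj : injective (fun i : 'I_k.+1 => inZp (i + l) : 'I_k.+1).
Proof.
move=> i j /(congr1 val) /= /eqP; rewrite eqn_modDr !modn_small // => /eqP.
exact: val_inj.
Qed.

Definition shift_perm : 'S_k.+1 := perm shift_perm_inj.

Lemma shift_permE (i : 'I_k.+1) :
  shift_perm i = (if i + l < k.+1 then i + l else i + l - k.+1)%N :> nat.
Proof.
rewrite permE /=; case: ifP => [/modn_small //|ge].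
rewrite -{1}(@subnK k.+1 (i + l)) ?modnDr ?modn_small //; last by lia.
by have := ltn_ord i; have := shift_le; lia.
Qed.

Lemma shift_perm_unwrapped (i : 'I_k.+1) :
  (b i < a (shift_perm i))%N = (i + l < k.+1)%N.
Proof.
have := shift_permE i; case: ifP => [_ /shift_good //|ge E].
apply/negbTE; rewrite -leqNgt.
have lti := ltn_ord i.
(* Since [i1 + l <= k.+1 <= i + l], the bottleneck lies at or before column [i], and the wrapped row
   index is at most [j1]. *)
have [i1 [j1 [E1 le1]]] : exists i j : 'I_k.+1, j.+1 = (i + l)%N /\ (a j <= b i)%N.
  by apply: shift_bottleneck; lia.
have ltj1 := ltn_ord j1.
apply: leq_trans (_ : _ <= a j1)%N (leq_trans le1 _); rewrite elt_leq; lia.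
Qed.

(* Columns where [s] agrees with the shift satisfy the bounds of
   [phi_lt_unwrapped] and [phi_lt_wrapped] as well, so the common part of the
   two matchings need not be removed before counting. *)
Lemma phi_min_shift_diff (s : 'S_k.+1) (i0 : 'I_k.+1) :
    s i0 != shift_perm i0 ->
  exists2 i, s i != shift_perm i &
    phi (a (s i)) (b i) <= phi (a (shift_perm i0)) (b i0).
Proof.
move=> ne0.
have [/existsP[i /andP[nei lei]]|/existsPn none] := boolP [exists i,
    (s i != shift_perm i) && (phi (a (s i)) (b i) <= phi (a (shift_perm i0)) (b i0))].
  by exists i.
have {none} H i : s i != shift_perm i ->
    phi (a (shift_perm i0)) (b i0) < phi (a (s i)) (b i).
  by move=> nei; have := none i; rewrite nei -ltNge.
exfalso.
have lew := shift_le_wrapped s; have lel := shift_le.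
have lti0 := ltn_ord i0; have E0 := shift_permE i0.
have ltE (i j : 'I_k.+1) : (a i < a j)%N = (i < j)%N.
  by rewrite ltnNge elt_leq -ltnNge.
have [unw|wr] := boolP (i0 + l < k.+1)%N.
  rewrite unw in E0; have unw0 := shift_perm_unwrapped i0; rewrite unw in unw0.
  have key (i : 'I_k.+1) : ((i <= i0) || (a (s i) <= b i) -> s i < i0 + l)%N /\
      (i <= i0 -> b i < a (s i))%N.
    have [eqi|nei] := eqVneq (s i) (shift_perm i).
      (* Agreement with the shift excludes [i0], which makes the bounds strict. *)
      have nei : (i != i0) by apply: contraNneq ne0 => <-; apply/eqP.
      have {}nei : (i != i0 :> nat)%N by [].
      rewrite [(a _ <= b _)%N]leqNgt eqi shift_perm_unwrapped shift_permE.
      have lti := ltn_ord i.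
      by case: ifP; lia.
    have [] := phi_lt_unwrapped (H _ nei) unw0.
    by rewrite elt_leq ltE E0.
  (* The wrapped columns and the [i0.+1] first columns are disjoint and share [i0 + l] rows, so
     fewer than [l] columns wrap. *)
  have dis : [disjoint wrapped s & [set i : 'I_k.+1 | i < i0.+1]%N].
    rewrite -setI_eq0; apply/eqP/setP => i; rewrite !inE ltnS.
    by case: (key i) => _; lia.
  have : wrapped s :|: [set i : 'I_k.+1 | i < i0.+1]%N \subset
      s @^-1: [set r : 'I_k.+1 | r < i0 + l]%N.
    apply/subsetP => i; rewrite !inE ltnS orbC; case: (key i) => kk _.
    exact: kk.
  move/subset_leq_card; rewrite card_preimset; last exact: perm_inj.
  rewrite cardsU (disjoint_setI0 dis) cards0 !card_ord_lt; lia.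
rewrite (negbTE wr) in E0.
have wr0 := shift_perm_unwrapped i0; rewrite (negbTE wr) in wr0.
have {}wr0 : (a (shift_perm i0) <= b i0)%N by rewrite leqNgt wr0.
have key (i : 'I_k.+1) : (i <= i0 -> a (s i) <= b i -> s i < i0 + l - k.+1)%N.
  have [eqi|nei] := eqVneq (s i) (shift_perm i).
    have nei : (i != i0) by apply: contraNneq ne0 => <-; apply/eqP.
    have {}nei : (i != i0 :> nat)%N by [].
    rewrite [(a _ <= b _)%N]leqNgt eqi shift_perm_unwrapped shift_permE.
    by case: ifP; lia.
  have := phi_lt_wrapped (H _ nei) wr0.
  by rewrite elt_leq ltE E0.
(* At most [k - i0] wrapped columns lie after [i0], the others share [i0 + l - k.+1] rows: again
   fewer than [l] in all. *)
have : wrapped s \subset [set i : 'I_k.+1 | i0.+1 <= i]%N :|: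
    s @^-1: [set r : 'I_k.+1 | r < i0 + l - k.+1]%N.
  apply/subsetP => i; rewrite !inE => wri.
  by case: (leqP i i0) => //= lei; apply: key.
move/subset_leq_card => /leq_trans/(_ (leq_card_setU _ _)).
rewrite card_preimset; last exact: perm_inj.
rewrite card_ord_ge card_ord_lt; lia.
Qed.

(** * Monomials of the minor *)

Definition perm_mnm (s : 'S_k.+1) : 'X_{1..n * n} :=
  (\sum_i U_(var (a (s i)) (b i)))%MM.

Lemma perm_mnmE (s : 'S_k.+1) (i j : 'I_k.+1) :
  perm_mnm s (var (a i) (b j)) = (s j == i).
Proof.
rewrite mnm_sumE (bigD1 j) //= big1 => [|j' nej]; rewrite mnm1E var_inj xpair_eqE.
  by rewrite (inj_eq (@elt_inj _ _ _ hA)) eqxx andbT addn0.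
by rewrite (inj_eq (@elt_inj _ _ _ hB)) (negbTE nej) andbF.
Qed.

Lemma perm_mnm_out (s : 'S_k.+1) (x y : 'I_n) :
  (forall i, (x, y) != (a (s i), b i)) -> perm_mnm s (var x y) = 0%N.
Proof.
move=> out; rewrite mnm_sumE big1 // => i _.
by rewrite mnm1E var_inj eq_sym (negbTE (out i)).
Qed.

Lemma perm_mnm_inj : injective perm_mnm.
Proof.
move=> s t E; apply/permP => j; apply/eqP.
have : perm_mnm t (var (a (t j)) (b j)) = 1%N by rewrite perm_mnmE eqxx.
by rewrite -E perm_mnmE; case: eqP.
Qed.

Lemma Nset_perm_mnm :
  (\sum_(p in Nset hA hB) U_(var p.1 p.2))%MM = perm_mnm shift_perm.
Proof.
rewrite big_imset /=; last by move=> i j _ _ [_ /elt_inj].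
by apply: eq_bigr => i _; rewrite permE.
Qed.

Lemma perm_mnm_drl_le (s : 'S_k.+1) :
  drl_le (perm_mnm s) (perm_mnm shift_perm).
Proof.
have [->|ne] := eqVneq s shift_perm; first by rewrite /drl_le eqxx.
have [i1 ne1] : exists i, s i != shift_perm i.
  by apply/existsP; apply: contraNT ne; rewrite negb_exists => /forallP eqs;
     apply/eqP/permP => i; apply/eqP; rewrite -[_ == _]negbK eqs.
apply/orP; right; apply/orP; right; apply/andP; split.
  by rewrite !mdeg_sum; apply/eqP/eq_bigr => i _; rewrite !mdeg1.
(* By [phi_min_shift_diff] no differing cell of the shift is smaller than the smallest one of [s],
   so the exponents first differ there. *)
case: (Order.TotalTheory.arg_minP (P := fun i => s i != shift_perm i)
  (fun i => phi (a (s i)) (b i)) ne1) => i2 ne2 min2.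
apply/existsP; exists (a (s i2)); apply/existsP; exists (b i2).
rewrite !perm_mnmE eqxx eq_sym (negbTE ne2) /=.
apply/forallP => x; apply/forallP => y; apply/implyP => ltxy.
have agree i : (x, y) = (a (s i), b i) \/ (x, y) = (a (shift_perm i), b i) ->
    s i = shift_perm i.
  move=> E; apply/eqP; apply: contraLR ltxy => nei; rewrite -leNgt.
  case: E => -[-> ->]; first exact: min2.
  by have [j /min2 le2] := phi_min_shift_diff nei; apply: le_trans.
have [/existsP[i /eqP E]|/existsPn out] :=
    boolP [exists i, (x, y) == (a (s i), b i)].
  by case: E (agree i) => -> -> ag; rewrite !perm_mnmE ag ?eqxx //; left.
rewrite !perm_mnm_out // => i.
by apply: contra (out i) => /eqP E; rewrite E agree //; right.
Qed.

Lemma det_submat (K : fieldType) :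
  \det (submat K hA hB) =
  \sum_(s : 'S_k.+1) (-1) ^+ s * 'X_[perm_mnm s].
Proof.
(* After transposition [s] sends columns to rows, as in [perm_mnm]. *)
rewrite -det_tr; apply: eq_bigr => s _; congr (_ * _).
rewrite /perm_mnm (big_morph _ (@mpolyXD _ K) (@mpolyX0 _ K)).
by apply: eq_bigr => i _; rewrite !mxE.
Qed.

End Shift.

Theorem theorem7p2 (K : fieldType) (n k : nat) (hn : (1 <= n)%N) (hk : (k < n)%N)
    (A B : {set 'I_n}) (hA : #|A| = k.+1) (hB : #|B| = k.+1) :
  is_lm (\det (submat K hA hB))
        (\sum_(p in Nset hA hB) U_(var p.1 p.2))%MM.
Proof.
have signE (s : 'S_k.+1) m : ((-1) ^+ s * 'X_[perm_mnm hA hB s] : {mpoly K[n * n]})@_m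
    = (-1) ^+ s * (perm_mnm hA hB s == m)%:R.
  by rewrite mulr_sign mulr_sign; case: (s : bool); rewrite ?mcoeffN mcoeffX.
rewrite Nset_perm_mnm det_submat; split=> [|m].
  (* No other permutation gives this monomial, so its coefficient is a sign, nonzero in every
     characteristic. *)
  rewrite mcoeff_msupp raddf_sum (bigD1 (shift_perm hA hB)) //= big1 => [|s ne].
    by rewrite addr0 signE eqxx mulr1 signr_eq0.
  by rewrite signE (inj_eq (@perm_mnm_inj _ _ _ _ hA hB)) (negbTE ne) mulr0.
rewrite mcoeff_msupp raddf_sum /= => nz.
have [/existsP[s /eqP <-]|/existsPn out] :=
    boolP [exists s, perm_mnm hA hB s == m]; first exact: perm_mnm_drl_le.
by rewrite big1 ?eqxx // in nz => s _; rewrite signE (negbTE (out s)) mulr0.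
Qed.
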